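(* Let $\lambda$ be a partition with $r$ parts (zero parts allowed), with degree sequence $n_\lambda=(n_{\lambda,1},\dots,n_{\lambda,r})$, and let $m\ge3$ be an odd integer with $\gcd(m,\Delta(n_\lambda))=1$. Then the residues $n_{\lambda,i}\bmod m\in\{0,1,\dots,m-1\}$, $1\le i\le r$, are pairwise distinct, so they form (as a set) the degree sequence of a unique partition $\mu$ of length $r$. Furthermore $$\mathrm{He}_\lambda(x)\equiv x^{|\lambda|-|\mu|}\,\mathrm{He}_\mu(x)\pmod m,$$ i.e. corresponding coefficients of the two integer polynomials are congruent modulo $m$.
   Context: $\mathrm{He}_k(x)$ denotes the monic probabilists' Hermite polynomial of degree $k$ (solution of $y''-xy'+ky=0$). A partition $\lambda=(\lambda_1\ge\dots\ge\lambda_r\ge 0)$ may have zero parts; $|\lambda|=\sum\lambda_i$. Its degree sequence is $n_\lambda=(\lambda_r,\lambda_{r-1}+1,\dots,\lambda_1+r-1)$; conversely any set of $r$ distinct non-negative integers is the degree sequence of exactly one partition of length $r$. $\Delta(x_1,\dots,x_r)=\prod_{i<j}(x_j-x_i)$. The Wronskian Hermite polynomial is $\mathrm{He}_\lambda(x)=\mathrm{Wr}[\mathrm{He}_{n_1},\dots,\mathrm{He}_{n_r}]/\Delta(n_\lambda)$ with $n_\lambda=(n_1,\dots,n_r)$; it is monic of degree $|\lambda|$ with integer coefficients. *)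

(* Defs.v *)
From HB Require Import structures.
From mathcomp Require Import all_boot all_order all_algebra.
Set Implicit Arguments. Unset Strict Implicit. Unset Printing Implicit Defensive.
Import Order.TTheory GRing.Theory Num.Theory.
Local Open Scope ring_scope.

(* Probabilists' Hermite polynomials over Q, via the three-term recurrence
   He_0 = 1, He_1 = x, He_{k+1} = x He_k - k He_{k-1}. *)
Fixpoint He_pair (k : nat) : {poly rat} * {poly rat} :=
  match k with
  | 0%N => (1, 'X)
  | k'.+1 => let (a, b) := He_pair k' in (b, 'X * b - (k'.+1)%:R *: a)
  end.
Definition He (k : nat) : {poly rat} := (He_pair k).1.

Definition is_partition (l : seq nat) : bool := sorted geq l.

Definition psize (l : seq nat) : nat := sumn l.

Definition degseq (l : seq nat) : seq nat :=
  [seq (nth 0%N (rev l) i + i)%N | i <- iota 0 (size l)].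

Definition Delta (n : seq nat) : int :=
  \prod_(i < size n) \prod_(j < size n | (i < j)%N)
     ((nth 0%N n j)%:Z - (nth 0%N n i)%:Z).

Definition Wr (fs : seq {poly rat}) : {poly rat} :=
  \det (\matrix_(i < size fs, j < size fs) (nth 0 fs j)^`(i)).

Definition He_part (l : seq nat) : {poly rat} :=
  ((Delta (degseq l))%:~R)^-1 *: Wr [seq He k | k <- degseq l].

(* Main.v *)
(** Let [chi] be the irreducible character of the symmetric group attached to
    [lambda] by Frobenius' formula.  Expanding Hermite polynomials over partial
    matchings shows that the coefficients of [He_lambda] are, up to sign, the
    sums of [chi g / chi 1] over the involutions [g] with a given number of fixed
    points.  These are central character values, hence rational algebraic
    integers, so [He_lambda] has integer coefficients.

    For odd [m] one has [He_m = x^m] modulo [m], and the three-term recurrence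
    gives [He_(q m + k) = x^(q m) He_k]; since [x^(q m)] has derivative zero, it
    factors out of the columns of the Wronskian.  The congruence follows after
    cancelling [Delta], which is a unit modulo [m]. *)

Require Import Defs.
From HB Require Import structures.
From mathcomp Require Import all_boot all_order all_fingroup all_algebra.
From mathcomp Require Import all_solvable all_field all_character.
From mathcomp Require Import mpoly ring zify.
Import Order.TTheory GRing.Theory Num.Theory.
Set Implicit Arguments. Unset Strict Implicit. Unset Printing Implicit Defensive.
Local Open Scope ring_scope.

(** * Hermite polynomials *)

(** Defined over any ring, so that the versions over [rat], [int] and ['Z_m] are compared through
    [map_herm]. *)
Fixpoint herm_pair (R : comNzRingType) (k : nat) : {poly R} * {poly R} :=
  match k with
  | 0%N => (1, 'X)
  | k'.+1 => let (a, b) := herm_pair R k' in (b, 'X * b - (k'.+1)%:R *: a)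
  end.

Definition herm (R : comNzRingType) (k : nat) : {poly R} := (herm_pair R k).1.

Lemma scale_natr (R : comNzRingType) k (p : {poly R}) : k%:R *: p = k%:R * p.
Proof. by rewrite -mul_polyC polyC_natr. Qed.

Section Hermite.
Variable R : comNzRingType.

Lemma herm0 : herm R 0 = 1. Proof. by []. Qed.

Lemma herm1 : herm R 1 = 'X. Proof. by []. Qed.

Lemma hermSS k : herm R k.+2 = 'X * herm R k.+1 - k.+1%:R * herm R k.
Proof. by rewrite -scale_natr /herm /=; case: (herm_pair R k) => a b. Qed.

Lemma hermS k : herm R k.+1 = 'X * herm R k - k%:R * herm R k.-1.
Proof. by case: k => [|k]; rewrite ?hermSS // herm1 herm0; ring. Qed.

Lemma two_step_ind (P : nat -> Prop) :
  P 0%N -> P 1%N -> (forall k, P k -> P k.+1 -> P k.+2) -> forall k, P k.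
Proof.
move=> P0 P1 PS k; suff: P k /\ P k.+1 by case.
by elim: k => [|k [Pk PSk]]; split=> //; apply: PS.
Qed.

Lemma deriv_herm k : (herm R k)^`() = k%:R * herm R k.-1.
Proof.
elim/two_step_ind: k => [||k IH0 IH1].
- by rewrite herm0 -polyC1 derivC mul0r.
- by rewrite herm1 derivX mul1r.
rewrite hermSS derivB derivM derivX mul1r -scale_natr derivZ scale_natr IH0 IH1.
rewrite /= hermS; ring.
Qed.

Lemma derivn_herm k i : (herm R k)^`(i) = (k ^_ i)%:R * herm R (k - i).
Proof.
elim: i => [|i IHi]; first by rewrite derivn0 ffactn0 mul1r subn0.
rewrite derivnS IHi -scale_natr derivZ scale_natr deriv_herm mulrA -natrM.
by rewrite ffactnSr subnS.
Qed.

Lemma coef_hermSS n i :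
  (herm R n.+2)`_i
    = (if i is i'.+1 then (herm R n.+1)`_i' else 0) - n.+1%:R * (herm R n)`_i.
Proof.
by rewrite hermSS coefB coefXM -scale_natr coefZ; case: i.
Qed.

Lemma coef_herm_eq0 n i : (n < i)%N || odd (n + i) -> (herm R n)`_i = 0.
Proof.
elim/two_step_ind: n i => [||n IH0 IH1] i H.
- by rewrite herm0 coef1; case: i H => //= i; rewrite ?addn0.
- by rewrite herm1 coefX; case: i H => [|[|i]].
rewrite coef_hermSS IH0 ?mulr0 ?subr0; last by move: H; lia.
by case: i H => // i H; apply: IH1; move: H; lia.
Qed.

(** The denominator 2^k k! of the classical closed form is cleared, so the formula holds over every
    ring and follows from the recurrence alone. *)
Lemma coef_herm i k :
  (2 ^ k * k`!)%:R * (herm R (i + k.*2))`_i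
    = (-1) ^+ k * ((i + k.*2) ^_ k.*2)%:R.
Proof.
move En: (i + k.*2)%N => n; elim/two_step_ind: n i k En => [||n IH0 IH1] i k En.
- have [-> ->] : i = 0%N /\ k = 0%N by lia.
  by rewrite herm0 coef1 expr0 ffactn0 !mulr1 expn0.
- have [-> ->] : i = 1%N /\ k = 0%N by lia.
  by rewrite herm1 coefX expr0 ffactn0 !mulr1 expn0.
rewrite coef_hermSS.
case: k En => [|k] En.
  rewrite (@coef_herm_eq0 n) ?mulr0 ?subr0; last by lia.
  case: i En => [|i] En; first by lia.
  by rewrite IH1 ?addn0 ?ffactn0 //; lia.
(* Pascal-type rule for falling factorials; its two terms match those of the recurrence. *)
have -> : ((n.+2) ^_ k.+1.*2 = n.+1 ^_ k.+1.*2 + k.+1.*2 * (n.+1 * n ^_ k.*2))%N.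
  rewrite doubleS [in LHS]ffactnS [in LHS]/= [in LHS]ffactnS.
  rewrite [in RHS]ffactnSr [in RHS]ffactnS /=.
  have [le|lt] := leqP k.*2 n; last by rewrite !ffact_small //; lia.
  have -> : n.+2 = (n.+1 - k.*2.+1 + k.*2.+2)%N by lia.
  by rewrite mulnDl; lia.
rewrite mulrBr natrD [(k.+1.*2 * _)%:R]natrM mulrDr.
have IH := IH0 i k ltac:(lia).
have {}IH : (2 ^ k.+1 * k.+1`!)%:R * (n.+1%:R * (herm R n)`_i)
   = - ((-1) ^+ k.+1 * ((k.+1.*2)%:R * (n.+1 * n ^_ k.*2)%:R)).
  rewrite expnS factS -muln2 !natrM.
  transitivity (2%:R * k.+1%:R * n.+1%:R * ((2 ^ k * k`!)%:R * (herm R n)`_i)).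
    by rewrite natrM; ring.
  by rewrite IH exprS; ring.
rewrite IH opprK; congr (_ + _).
(* For [i = 0] the shifted term is absent, and the falling factorial of [n.+1] vanishes because it
   has [n.+2] factors. *)
case: i En {IH} => [|i] En.
  by rewrite mulr0 ffact_small ?mulr0 //; lia.
by rewrite IH1 //; lia.
Qed.
End Hermite.

Lemma map_herm (R S : comNzRingType) (f : {rmorphism R -> S}) k :
  map_poly f (herm R k) = herm S k.
Proof.
elim/two_step_ind: k => [||k IH0 IH1].
- by rewrite !herm0 rmorph1.
- by rewrite !herm1 map_polyX.
by rewrite !hermSS rmorphB !rmorphM /= map_polyX IH0 IH1 rmorph_nat.
Qed.

Lemma He_herm k : He k = herm rat k.
Proof.
have E : He_pair k = herm_pair rat k by elim: k => //= k ->.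
by rewrite /He E.
Qed.

Lemma ffactnD n a b : (n ^_ (a + b) = n ^_ a * (n - a) ^_ b)%N.
Proof.
elim: b => [|b IHb]; first by rewrite addn0 muln1.
by rewrite addnS !ffactnSr IHb -mulnA subnDA.
Qed.

(** * Hermite polynomials modulo an odd integer *)

Section HermiteModOdd.
Variable m : nat.
Hypotheses (m_gt1 : (1 < m)%N) (m_odd : odd m).

Let nat0 k : (m %| k)%N -> k%:R = 0 :> 'Z_m.
Proof. by move=> /dvdnP[q ->]; rewrite natrM pchar_Zp // mulr0. Qed.

(* 2 ^ k is a unit modulo [m] and [m * k`!] divides the falling factorial
   [m ^_ k.*2], so all but the leading coefficient vanish. *)
Lemma herm_mod_odd : herm 'Z_m m = 'X^m.
Proof.
apply/polyP=> i; rewrite coefXn.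
have [->|ne_im] := eqVneq i m.
  by have := coef_herm 'Z_m m 0; rewrite /= addn0 expr0 ffactn0 !mul1r.
case: (boolP ((m < i)%N || odd (m + i))) => [/coef_herm_eq0-> //|].
rewrite negb_or -leqNgt => /andP[le_im ev].
have [k [Ek k_gt0]] : exists k, (i + k.*2)%N = m /\ (0 < k)%N.
  by exists (m - i)./2; lia.
suff /eqP : ((2 ^ k)%:R : 'Z_m) * (herm 'Z_m m)`_i = 0.
  have U : ((2 ^ k)%:R : 'Z_m) \is a GRing.unit.
    by rewrite unitZpE // coprimeXr // coprimen2.
  by rewrite -[X in _ == X](mulr0 (2 ^ k)%:R) => /eqP/(mulrI U).
(* The factor k! need not be a unit modulo [m], so it is cancelled over the integers before
   reducing. *)
have := coef_herm int i k; rewrite Ek.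
have -> : (m ^_ k.*2 = k`! * (m * ((m.-1) ^_ k.-1 * 'C(m - k, k))))%N.
  rewrite -addnn ffactnD -(bin_ffact (m - k)).
  have -> : (m ^_ k = m * m.-1 ^_ k.-1)%N by case: (k) k_gt0.
  lia.
rewrite !natrM [X in X * _]mulrC mulrCA -mulrA.
move/(mulfI (_ : (k`!%:R : int) != 0)) => H.
have {H} := H _; rewrite pnatr_eq0 -lt0n fact_gt0 => /(_ isT) H.
have := congr1 (fun z : int => (z%:~R : ('Z_m))) H.
rewrite /= !rmorphM /= !rmorph_nat -(coef_map (intmul 1)) /=.
by rewrite map_herm pchar_Zp // mul0r mulr0.
Qed.

(** The coefficients of the recurrence only depend on the index modulo [m], so both sides satisfy
    the same recurrence in [k]. *)
Lemma herm_addm k : herm ('Z_m) (m + k) = 'X^m * herm 'Z_m k.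
Proof.
elim/two_step_ind: k => [||k IH0 IH1].
- by rewrite addn0 herm_mod_odd herm0 mulr1.
- rewrite addn1 hermS herm_mod_odd herm1 -scale_natr pchar_Zp // scale0r.
  by rewrite subr0 mulrC.
rewrite !addnS hermSS -addnS IH0 IH1 hermSS.
rewrite -!scale_natr natrD pchar_Zp // add0r !scale_natr; ring.
Qed.

Lemma herm_addMm q k : herm ('Z_m) (q * m + k) = 'X^(q * m) * herm 'Z_m k.
Proof.
elim: q => [|q IHq]; first by rewrite mul0n add0n mul1r.
by rewrite mulSn -addnA herm_addm IHq mulrA -exprD.
Qed.

Lemma derivn_expMm q i (p : {poly 'Z_m}) :
  ('X^(q * m) * p)^`(i) = 'X^(q * m) * p^`(i).
Proof.
elim: i => // i IHi; rewrite !derivnS IHi derivM derivXn.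
by rewrite mulrnAl -mulr_natl -scale_natr nat0 ?dvdn_mull // scale0r add0r.
Qed.
End HermiteModOdd.

(** * Permutations preserving a word *)

Section Words.
Variables (T C : finType).
Implicit Types (S : {set T}) (w : T -> C) (g : {perm T}).

Definition preserves w g : bool := [forall a, w (g a) == w a].

Definition fiber w S c : nat := #|[set a in S | w a == c]|.

Lemma preservesP w g : reflect (forall a, w (g a) = w a) (preserves w g).
Proof. exact: (iffP 'forall_eqP). Qed.

(** Coset decomposition for the stabiliser of [a]: a permutation of [S] sending [a] to [b] is
    uniquely one fixing [a] followed by [tperm a b]. This lets sums over permutations be computed by
    removing one point at a time. *)
Lemma perm_on_tperm S a b g : a \in S -> b \in S ->
  perm_on S (g * tperm a b)%g && ((g * tperm a b)%g a == b)
    = perm_on (S :\ a) g.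
Proof.
move=> aS bS; apply/andP/idP => [[gS /eqP gab]|gS].
  apply/subsetP=> x; rewrite inE /= => gx.
  have ga : g a = a.
    by move: gab; rewrite permM => /(canRL (tpermK a b)); rewrite tpermR.
  rewrite !inE; apply/andP; split.
    by apply: contraNneq gx => ->; rewrite ga.
  apply: contraR gx => xS; have := out_perm gS xS.
  rewrite permM => /(canRL (tpermK a b)) ->.
  by rewrite tpermD //; apply: contraNneq xS => <-.
have ga : g a = a by apply: (out_perm gS); rewrite !inE eqxx.
rewrite permM ga tpermL eqxx; split=> //.
apply: perm_onM.
  by apply: subset_trans gS _; apply: subD1set.
by apply/subsetP=> x; rewrite inE /=; case: tpermP => [->|->|]; rewrite ?eqxx.
Qed.

Lemma sum_perm_on (R : nmodType) (F : {perm T} -> R) S a : a \in S ->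
  \sum_(g | perm_on S g) F g
    = \sum_(b in S) \sum_(g | perm_on (S :\ a) g) F (g * tperm a b)%g.
Proof.
move=> aS; rewrite (partition_big (fun g => g a) (mem S)) /=; last first.
  by move=> g gS; rewrite perm_closed.
apply: eq_bigr => b bS.
rewrite (reindex_inj (mulIg (tperm a b))) /=.
by apply: eq_bigl => g; rewrite perm_on_tperm.
Qed.

Lemma preserves_tperm w a b g : g a = a ->
  preserves w (g * tperm a b)%g = (w b == w a) && preserves w g.
Proof.
move=> ga; apply/preservesP/andP => [H|[/eqP wb /preservesP H] x].
  have wb : w b = w a by rewrite -(H a) permM ga tpermL.
  split; [exact/eqP|apply/preservesP=> x].
  by rewrite -(H x) permM; case: tpermP => [->|->|].
by rewrite permM -(H x); case: tpermP => [->|->|].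
Qed.

Lemma fiberD1 w S a c : a \in S ->
  fiber w S c = ((w a == c) + fiber w (S :\ a) c)%N.
Proof.
move=> aS; rewrite /fiber (cardsD1 a) inE aS /=; congr (_ + #|pred_of_set _|)%N.
by apply/setP=> x; rewrite !inE andbA.
Qed.

Lemma perm_on0 g : perm_on set0 g = (g == 1%g).
Proof.
apply/idP/eqP => [H|->]; last exact: perm_on1.
by apply/permP=> x; rewrite perm1 (out_perm H) ?inE.
Qed.

(** Order of a Young subgroup. The image of [a] can be any point of [S] carrying the letter [w a],
    and the rest is a permutation of [S :\ a]. *)
Lemma card_preserves_on w S :
  (\sum_(g | perm_on S g) preserves w g = \prod_c (fiber w S c)`!)%N.
Proof.
move En: #|S| => n; elim: n S En => [|n IHn] S En.
  move/eqP: En; rewrite cards_eq0 => /eqP->.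
  rewrite (eq_bigl _ _ perm_on0) big_pred1_eq big1 => [|c _].
    by case: preservesP => // -[] a; rewrite perm1.
  by rewrite /fiber (eq_card0 (A := [set a in set0 | w a == c])) // => x; rewrite !inE.
have /card_gt0P[a aS] : (0 < #|S|)%N by rewrite En.
have IH : (\sum_(g | perm_on (S :\ a) g) preserves w g
           = \prod_c (fiber w (S :\ a) c)`!)%N.
  by apply: IHn; move: En; rewrite (cardsD1 a) aS => -[].
rewrite (@sum_perm_on nat _ S a aS).
transitivity (\sum_(b in S) (w b == w a) * \prod_c (fiber w (S :\ a) c)`!)%N.
  apply: eq_bigr => b bS; rewrite -IH big_distrr /=.
  apply: eq_bigr => g gS; rewrite preserves_tperm ?mulnb //.
  by apply: (out_perm gS); rewrite !inE eqxx.
rewrite -big_distrl /= (bigD1 (w a)) //= [RHS](bigD1 (w a)) //=.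
have -> : (\sum_(b in S) (w b == w a) = (fiber w (S :\ a) (w a)).+1)%N.
  have <- : fiber w S (w a) = (fiber w (S :\ a) (w a)).+1.
    by rewrite (@fiberD1 w S a (w a)) // eqxx.
  rewrite /fiber -sum1_card [RHS]big_mkcond [LHS]big_mkcond /=.
  by apply: eq_bigr => b _; rewrite inE; case: (b \in S); case: eqP.
rewrite (@fiberD1 w S a (w a)) // eqxx factS mulnA; congr (_ * _)%N.
by apply: eq_bigr => c ne; rewrite (@fiberD1 w S a c) // eq_sym (negPf ne).
Qed.

Lemma card_preserves w :
  (\sum_g preserves w g = \prod_c (fiber w setT c)`!)%N.
Proof.
rewrite -card_preserves_on; apply: eq_bigl => g.
by symmetry; apply/subsetP=> x _; rewrite inE.
Qed.

Definition nfix S g : nat := #|[set a in S | g a == a]|.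

Lemma nfixD1 S g a : a \in S -> nfix S g = ((g a == a) + nfix (S :\ a) g)%N.
Proof.
move=> aS; rewrite /nfix (cardsD1 a) inE aS /=; congr (_ + #|pred_of_set _|)%N.
by apply/setP=> x; rewrite !inE andbA.
Qed.

(** * Products of Hermite polynomials as signed sums over partial matchings *)

Section MatchingPolynomial.
Variable R : comNzRingType.

(** An involution is a partial matching: unmatched points contribute ['X], matched pairs contribute
    -1 through the sign, and [preserves] only allows pairs of equal letters. *)
Definition invol_weight w S g : {poly R} :=
  ((g * g == 1)%g && preserves w g)%:R * ((-1) ^+ g * 'X^(nfix S g)).

Lemma involP g : reflect (forall x, g (g x) = x) (g * g == 1)%g.
Proof.
apply: (iffP eqP) => [/permP H x|H]; first by rewrite -permM H perm1.
by apply/permP=> x; rewrite permM H perm1.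
Qed.

Lemma invol_weight_id w S a g : a \in S -> perm_on (S :\ a) g ->
  invol_weight w S (g * tperm a a)%g = 'X * invol_weight w (S :\ a) g.
Proof.
move=> aS gS; rewrite tperm1 mulg1 /invol_weight.
rewrite (nfixD1 g aS).
have ga : g a = a by apply: (out_perm gS); rewrite !inE eqxx.
by rewrite ga eqxx add1n exprS [RHS]mulrCA; congr (_ * _); rewrite mulrCA.
Qed.

(** An involution sending [a] to [b] must send [b] back to [a], which forces [g] to fix [b];
    removing the pair then costs one sign. *)
Lemma invol_weight_swap w S a b g :
    a \in S -> b \in S :\ a -> perm_on (S :\ a) g ->
  invol_weight w S (g * tperm a b)%g
    = - ((w b == w a) && perm_on (S :\ a :\ b) g)%:R
        * invol_weight w (S :\ a :\ b) g.
Proof.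
move=> aS bS gS.
have ga : g a = a by apply: (out_perm gS); rewrite !inE eqxx.
have nab : b != a by move: bS; rewrite !inE => /andP[].
rewrite /invol_weight preserves_tperm //.
have [onb|noff] := boolP (perm_on (S :\ a :\ b) g); last first.
  rewrite andbF oppr0 mul0r.
  have [/involP H|] := boolP (_ == 1)%g; last by rewrite mul0r.
  case/negP: noff; apply/subsetP=> x xg.
  rewrite in_setD1 (subsetP gS x xg) andbT.
  apply: contraNneq xg => ->; 
  have := H a; rewrite !permM ga tpermL.
  by move/(canRL (tpermK a b)); rewrite tpermL => ->.
rewrite andbT.
have gb : g b = b by apply: (out_perm onb); rewrite !inE eqxx.
have nfx x y : g y = y -> x != y -> y != g x.
  by move=> gy; apply: contraNneq => /esym; rewrite -{1}gy => /perm_inj->.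
have -> : (g * tperm a b * (g * tperm a b) = g * g)%g.
  have c : commute g (tperm a b).
    apply/permP=> x; rewrite !permM.
    case: (tpermP a b x) => [->|->|/eqP na /eqP nb].
    - by rewrite ga gb tpermL.
    - by rewrite gb ga tpermR.
    by rewrite ?tpermD ?nfx // 1?eq_sym.
  by rewrite mulgA -[(_ * _ * g)%g]mulgA -c mulgA -mulgA tperm2 mulg1.
have -> : ((-1) ^+ (g * tperm a b)%g : {poly R}) = - (-1) ^+ g.
  by rewrite odd_permM odd_tperm eq_sym nab signr_addb expr1 mulrN1.
have -> : nfix S (g * tperm a b)%g = nfix (S :\ a :\ b) g.
  rewrite (nfixD1 _ aS) (nfixD1 _ bS) !permM ga gb tpermL tpermR.
  rewrite (negPf nab) eq_sym (negPf nab) !add0n.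
  congr #|pred_of_set _|; apply/setP=> x; rewrite !inE.
  case: (eqVneq x b) => //= xb; case: (eqVneq x a) => //= xa.
  by rewrite permM tpermD ?nfx // 1?eq_sym.
move: ((-1) ^+ g : {poly R}) ('X^_) => s x.
by case: (_ == 1)%g; case: (w b == w a); case: (preserves w g) => /=; ring.
Qed.

(** This is the Hermite recurrence in the factor of the letter [w a]: its coefficient [k] counts the
    other points [b] with the same letter, that is, the possible partners of [a]. *)
Lemma prod_herm_fiberD1 w S a : a \in S ->
  \prod_c herm R (fiber w S c)
    = 'X * \prod_c herm R (fiber w (S :\ a) c)
      - \sum_(b in S :\ a) (w b == w a)%:R
          * \prod_c herm R (fiber w (S :\ a :\ b) c).
Proof.
move=> aS; set k := fiber w (S :\ a) (w a).
pose P := \prod_(c | c != w a) herm R (fiber w (S :\ a) c).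
have E S' j : fiber w S' (w a) = j ->
    (forall c, c != w a -> fiber w S' c = fiber w (S :\ a) c) ->
    \prod_c herm R (fiber w S' c) = herm R j * P.
  move=> Ej Ec; rewrite (bigD1 (w a)) //= Ej; congr (_ * _).
  by apply: eq_bigr => c /Ec->.
rewrite (E S k.+1); first last.
- by move=> c ne; rewrite (fiberD1 _ _ aS) eq_sym (negPf ne).
- by rewrite (fiberD1 _ _ aS) eqxx.
rewrite (E (S :\ a) k) // hermS.
rewrite (eq_bigr (fun b => (w b == w a)%:R * (herm R k.-1 * P))); last first.
  move=> b bS; have [wb|] := eqVneq; last by rewrite !mul0r.
  rewrite (E _ k.-1) //.
    by rewrite /k (fiberD1 _ _ bS) wb eqxx.
  by move=> c ne; rewrite [RHS](fiberD1 _ _ bS) wb eq_sym (negPf ne).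
rewrite -big_distrl /= -natr_sum.
have -> : (\sum_(b in S :\ a) (w b == w a) = k)%N.
  rewrite /k /fiber -sum1_card [RHS]big_mkcond [LHS]big_mkcond /=.
  by apply: eq_bigr => b _; rewrite !inE; do 2!case: eqP => //=; case: (b \in S).
ring.
Qed.

(** Both sides obey the same recursion, according to whether [a] is fixed or paired with some [b].
    Strong induction is used since a pair removes two points. *)
Lemma sum_invol_on w S :
  \sum_(g | perm_on S g) invol_weight w S g = \prod_c herm R (fiber w S c).
Proof.
have [n le_n] := ubnP #|S|; elim: n S le_n => // n IHn S le_n.
have [->|[a aS]] := set_0Vmem S.
  rewrite (eq_bigl _ _ perm_on0) big_pred1_eq big1 => [|c _]; last first.
    rewrite /fiber (eq_card0 (A := [set a in set0 | w a == c])) ?herm0 // => x.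
    by rewrite !inE.
  rewrite /invol_weight mulg1 eqxx odd_perm1 expr0 mul1r.
  rewrite /nfix (eq_card0 (A := [set a in set0 | _])); last first.
    by move=> x; rewrite !inE.
  rewrite expr0 mulr1; case: preservesP => // -[] a; by rewrite perm1.
have le1 : (#|S :\ a| < n)%N by move: le_n; rewrite (cardsD1 a) aS; lia.
rewrite (sum_perm_on _ aS) (bigD1 a) //= (prod_herm_fiberD1 _ aS).
congr (_ + _).
  rewrite -IHn // big_distrr /=; apply: eq_bigr => g.
  exact: invol_weight_id.
rewrite -sumrN; apply: eq_big => [b|b /andP[bS nb]].
  by rewrite !inE andbC.
have bS' : b \in S :\ a by rewrite !inE nb.
rewrite -IHn; last by move: le1; rewrite (cardsD1 b) bS'; lia.
rewrite (eq_bigr _ (fun g => invol_weight_swap w aS bS')).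
rewrite big_distrr /= -sumrN [LHS]big_mkcond [RHS]big_mkcond /=.
apply: eq_bigr => g _.
have [on|_] := boolP (perm_on (S :\ a :\ b) g).
  have -> : perm_on (S :\ a) g.
    by apply: subset_trans on _; apply: subD1set.
  by rewrite andbT mulNr.
by case: ifP => _; rewrite // andbF oppr0 mul0r.
Qed.

Lemma sum_invol w :
  \sum_g invol_weight w setT g = \prod_c herm R (fiber w setT c).
Proof.
rewrite -sum_invol_on; apply: eq_bigl => g.
by symmetry; apply/subsetP=> x _; rewrite inE.
Qed.

End MatchingPolynomial.
End Words.

(** * Permutation characters on words *)

Section PermutationCharacter.
Variables (gT : finGroupType) (G : {group gT}) (T : finType).
Variables (to : {action gT &-> T}) (S : {set T}).
Hypothesis actsS : [acts G, on S | to].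

Definition perm_rep_mx (g : gT) : 'M[algC]_#|S| :=
  \matrix_(i, j) (to (enum_val i) g == enum_val j)%:R.

Lemma perm_rep_repr : mx_repr G perm_rep_mx.
Proof.
split=> [|g h gG hG]; apply/matrixP=> i j; rewrite !mxE.
  by rewrite act1 (inj_eq enum_val_inj).
have iS : to (enum_val i) g \in S by rewrite (acts_act actsS gG) enum_valP.
rewrite (bigD1 (enum_rank_in iS (to (enum_val i) g))) //= !mxE.
rewrite enum_rankK_in // eqxx mul1r actM big1 ?addr0 // => k nk.
rewrite !mxE; case: eqP => [e|]; last by rewrite mul0r.
by case/eqP: nk; apply: enum_val_inj; rewrite enum_rankK_in ?enum_valP.
Qed.

Lemma perm_char :
  exists2 phi : 'CF(G), phi \is a character
    & forall g, g \in G -> phi g = #|[set x in S | to x g == x]|%:R.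
Proof.
exists (cfRepr (MxRepresentation perm_rep_repr)); first exact: cfRepr_char.
move=> g gG; rewrite cfunE gG mulr1n /= /mxtrace.
transitivity (\sum_(i < #|S|) (to (enum_val i) g == enum_val i)%:R : algC).
  by apply: eq_bigr => i _; rewrite mxE.
rewrite -(big_enum_val (A := mem S) (fun x : T => (to x g == x)%:R)) /=.
rewrite -sum1_card natr_sum big_mkcond [RHS]big_mkcond; apply: eq_bigr => x _.
by rewrite inE; case: (x \in S) => //=; case: eqP.
Qed.
End PermutationCharacter.

(** * The symmetric group acting on words by positions *)

Section WordAction.
Variables (N : nat) (C : finType).
Implicit Types (w : {ffun 'I_N -> C}) (g : {perm 'I_N}).

(** The inverse makes this a right action for products of permutations read from left to right. *)
Definition word_act w g : {ffun 'I_N -> C} := [ffun a => w (g^-1%g a)].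

Lemma word_act1 : word_act^~ 1%g =1 id.
Proof. by move=> w; apply/ffunP=> a; rewrite ffunE invg1 perm1. Qed.

Lemma word_actM w : act_morph word_act w.
Proof. by move=> g h; apply/ffunP=> a; rewrite !ffunE invMg permM. Qed.

Definition word_action := TotalAction word_act1 word_actM.

Lemma word_act_fix w g : (word_act w g == w) = preserves w g.
Proof.
apply/eqP/preservesP => [/ffunP E a|E]; last apply/ffunP=> a.
  by rewrite -(E (g a)) ffunE permK.
by rewrite ffunE -[in RHS](permKV g a) E.
Qed.

Lemma fiber_count w c : fiber w setT c = count_mem c [tuple w i | i < N].
Proof.
rewrite /fiber -sum1_card -sum1_count big_map big_enum_cond /=.
by apply: eq_bigl => a; rewrite !inE.
Qed.

Lemma fiber_word_act w g c : fiber (word_act w g) setT c = fiber w setT c.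
Proof.
rewrite /fiber -[RHS](card_imset _ (@perm_inj _ g)); apply: eq_card => a.
rewrite !inE; apply/idP/imsetP => [|[b]]; last first.
  by rewrite !inE ffunE => wb ->; rewrite permK.
by rewrite ffunE /= => wa; exists (g^-1%g a); rewrite ?inE ?permKV.
Qed.

Lemma orbit_word w : orbit word_action setT w
  = [set v : {ffun 'I_N -> C} | [forall c, fiber v setT c == fiber w setT c]].
Proof.
apply/setP=> v; rewrite inE; apply/orbitP/'forall_eqP => [[g _ <-] c|E].
  exact: fiber_word_act.
have /tuple_permP[p Ep] : perm_eq [tuple v i | i < N] [tuple w i | i < N].
  by apply/allP=> c _ /=; rewrite -!fiber_count E.
exists p^-1%g; rewrite ?inE //; apply/ffunP=> a; rewrite ffunE invgK.
have := congr1 (fun s => nth (v a) s a) Ep.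
rewrite -[LHS]/(nth (v a) [tuple v i | i < N] a) -!tnth_nth !tnth_mktuple.
by move=> ->.
Qed.

Lemma word_exists (A : C -> nat) : (\sum_c A c = N)%N ->
  exists w, forall c, fiber w setT c = A c.
Proof.
move=> sA; pose s := flatten [seq nseq (A c) c | c <- index_enum C].
have sz : size s == N.
  rewrite size_flatten /shape -map_comp sumnE big_map -sA.
  by apply/eqP; apply: eq_bigr => c _; rewrite /= size_nseq.
exists [ffun i => tnth (Tuple sz) i] => c; rewrite fiber_count.
rewrite (_ : [tuple _ | i < N] = Tuple sz); last first.
  by apply: eq_from_tnth => i; rewrite tnth_mktuple ffunE.
rewrite /= count_flatten -map_comp sumnE big_map (bigD1 c) //=.
rewrite count_nseq /= eqxx mul1n big1 ?addn0 // => d nd.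
by rewrite count_nseq /= (negPf nd) mul0n.
Qed.

(** Multinomial count by orbit and stabiliser: the words of given content form one orbit, whose
    stabiliser is counted by [card_preserves]. *)
Lemma card_words (A : C -> nat) : (\sum_c A c = N)%N ->
  (#|[set w : {ffun 'I_N -> C} | [forall c, fiber w setT c == A c]]|
     * \prod_c (A c)`! = N`!)%N.
Proof.
move=> /word_exists[w EA].
have -> : [set v : {ffun 'I_N -> C} | [forall c, fiber v setT c == A c]]
    = orbit word_action setT w.
  by rewrite orbit_word; apply/setP=> v; rewrite !inE; apply: eq_forallb => c;
     rewrite EA.
have := card_orbit_in_stab word_action w (subxx [set: {perm 'I_N}]).
rewrite cardsT card_Sn => <-; congr (_ * _)%N.
under eq_bigr do rewrite -EA.
rewrite -card_preserves -sum1_card big_mkcond [RHS]big_mkcond /=.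
apply: eq_bigr => g _; rewrite !inE /= sub1set inE /= word_act_fix.
by case: preserves.
Qed.

End WordAction.

(** * The Jacobi-Trudi identity *)

Section JacobiTrudi.
Variables (R : comNzRingType) (r B : nat) (x : 'I_r -> R).

Definition geo l : {poly R} := \sum_(a < B) (x l *: 'X) ^+ a.

(* The complete homogeneous symmetric polynomial, only for [k < B]: the
   geometric series are truncated. *)
Definition chs k : R := (\prod_l geo l)`_k.

(** Generating polynomial of the signed elementary symmetric functions in the variables other than
    [x l]. Multiplied by all geometric series it leaves only that of [x l]. *)
Definition cofactor_poly l : {poly R} := \prod_(i | i != l) (1 - x i *: 'X).

Lemma geo_mul l : (1 - x l *: 'X) * geo l = 1 - x l ^+ B *: 'X^B.
Proof.
by rewrite -opprB mulNr /geo -subrX1 opprB exprZn.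
Qed.

Lemma coef_geo l k : (k < B)%N -> (geo l)`_k = x l ^+ k.
Proof.
move=> kB; rewrite /geo coef_sum (bigD1 (Ordinal kB)) //=.
rewrite exprZn coefZ coefXn eqxx mulr1 big1 ?addr0 // => a na.
rewrite exprZn coefZ coefXn; case: eqP => [e|]; last by rewrite mulr0.
by case/eqP: na; apply: val_inj.
Qed.

Lemma coef_prod_1subXn (I : Type) (s : seq I) (P : pred I) (c : I -> R) p k :
  (k < B)%N -> ((\prod_(i <- s | P i) (1 - c i *: 'X^B)) * p)`_k = p`_k.
Proof.
move=> kB; elim: s => [|i s IHs]; first by rewrite big_nil mul1r.
rewrite big_cons; case: (P i) => //.
by rewrite -mulrA mulrBl mul1r coefB -scalerAl coefZ coefXnM kB mulr0 subr0.
Qed.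

Lemma coef_cofactor_mul l k : (k < B)%N ->
  (cofactor_poly l * \prod_i geo i)`_k = x l ^+ k.
Proof.
move=> kB; rewrite (bigD1 l) //= mulrCA mulrC -big_split /=.
rewrite (eq_bigr (fun i => 1 - x i ^+ B *: 'X^B)) => [|i _]; last exact: geo_mul.
by rewrite coef_prod_1subXn // coef_geo.
Qed.

Lemma size_cofactor l : (size (cofactor_poly l) <= r)%N.
Proof.
apply: leq_trans (size_poly_prod_leq _ _) _.
have r0 : (0 < r)%N by case: (r) l => // -[].
have Ec : #|[pred i | i != l]| = r.-1 by rewrite cardC1 card_ord.

have : (\sum_(i | i != l) size (1 - x i *: 'X)%R <= r.-1 * 2)%N.
  rewrite -Ec -sum_nat_const; apply: leq_sum => i _.
  rewrite (leq_trans (size_polyD _ _)) // geq_max size_poly1 size_polyN.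
  by rewrite (leq_trans (size_scale_leq _ _)) ?size_polyX.
rewrite Ec -ltnS => le; rewrite leq_subLR; apply: leq_trans le _.
by lia.
Qed.

Lemma expr_chs l n : (n < B)%N ->
  x l ^+ n = \sum_(k < r) (if (k <= n)%N then chs (n - k) else 0)
               * (cofactor_poly l)`_k.
Proof.
move=> nB; rewrite -coef_cofactor_mul // coefM.
(* Both sums are widened to a common range: terms with [k > n] vanish by the convention on [chs],
   those with [k >= r] by the degree of the cofactor polynomial. *)
rewrite (big_ord_widen (r + n.+1) (fun k =>
  (cofactor_poly l)`_k * (\prod_i geo i)`_(n - k))) ?leq_addl //.
rewrite (big_ord_widen (r + n.+1) (fun k =>
  (if (k <= n)%N then chs (n - k) else 0) * (cofactor_poly l)`_k)) ?leq_addr //.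
rewrite big_mkcond [RHS]big_mkcond /=; apply: eq_bigr => k _; rewrite ltnS.
case: (leqP k n) => kn; case: (ltnP k r) => kr; rewrite ?mul0r //; first exact: mulrC.
by rewrite nth_default ?mul0r // (leq_trans (size_cofactor l)).
Qed.

(** The Jacobi-Trudi matrix; the test encodes that complete symmetric functions of negative degree
    are zero. *)
Definition chs_mx (n : 'I_r -> nat) : 'M[R]_r :=
  \matrix_(j, i) (if (i <= n j)%N then chs (n j - i) else 0).

Lemma chs_mx_cofactor n : (forall j, n j < B)%N ->
  chs_mx n *m \matrix_(i, l) (cofactor_poly l)`_i = \matrix_(j, l) x l ^+ n j.
Proof.
move=> nB; apply/matrixP=> j l; rewrite !mxE (expr_chs _ (nB j)).
by apply: eq_bigr => k _; rewrite !mxE.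
Qed.

Lemma chs0 : (0 < B)%N -> chs 0 = 1.
Proof.
move=> B0; rewrite /chs coef0_prod big1 // => l _.
by rewrite coef_geo.
Qed.

(* Jacobi-Trudi; the determinant of cofactor polynomials is identified by
   taking [n = 0, 1, ..., r - 1]. *)
Lemma jacobi_trudi (n : 'I_r -> nat) : (forall j, n j < B)%N -> (r <= B)%N ->
  \det (chs_mx n) * \det (\matrix_(i, l) x l ^+ (i : nat))
    = \det (\matrix_(j, l) x l ^+ n j).
Proof.
move=> nB rB; have idB (j : 'I_r) : (j < B)%N by apply: leq_trans rB.
rewrite -(chs_mx_cofactor nB) det_mulmx; congr (_ * _).
rewrite -(@chs_mx_cofactor (fun j : 'I_r => j : nat)) // det_mulmx.
rewrite (det_trig (A := chs_mx _)).
  rewrite big1 ?mul1r // => i _; rewrite mxE leqnn subnn chs0 //.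
  exact: leq_ltn_trans (idB i).
apply/is_trig_mxP=> i j ij; rewrite mxE leqNgt ij //.
Qed.

Lemma chsE k :
  chs k = \sum_(a : {ffun 'I_r -> 'I_B} | (\sum_l a l == k)%N)
            \prod_l x l ^+ a l.
Proof.
rewrite /chs /geo bigA_distr_bigA /= coef_sum [RHS]big_mkcond /=.
apply: eq_bigr => a _; under eq_bigr do rewrite exprZn.
rewrite scaler_prod -expr_sum coefZ coefXn eq_sym.
by case: eqP => _; rewrite ?mulr1 ?mulr0.
Qed.

Lemma det_expr (n : 'I_r -> nat) :
  \det (\matrix_(j, l) x l ^+ n j)
    = \sum_(s : 'S_r) (-1) ^+ s * \prod_l x l ^+ n (s l).
Proof.
rewrite -det_tr; apply: eq_bigr => s _; congr (_ * _).
by apply: eq_bigr => l _; rewrite !mxE.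
Qed.
End JacobiTrudi.

(** * Signed count of arrays with prescribed row and column sums *)

Section AlternatingCount.
Variables (r B : nat) (n : 'I_r -> nat).
Hypotheses (n_inj : injective n) (nB : forall j, (n j < B)%N) (rB : (r <= B)%N).

(** Row sums are [n j - t j] and column sums [n l - s l]; the additive form leaves no array when a
    difference would be negative. *)
Definition alt_arrays (t s : 'S_r) : {set {ffun 'I_r -> {ffun 'I_r -> 'I_B}}} :=
  [set A : {ffun 'I_r -> {ffun 'I_r -> 'I_B}} |
    [forall j, (\sum_l A j l + t j == n j)%N]
        & [forall l, (\sum_j A j l + s l == n l)%N]].

Let X l : {mpoly int[r]} := 'X_l.

Lemma prod_mvar (e : 'I_r -> nat) :
  \prod_l X l ^+ e l = 'X_[[multinom e l | l < r]].
Proof. by rewrite mpolyXE_id; apply: eq_bigr => l _; rewrite mnmE. Qed.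

(** Row [j] of the array is the exponent vector of the monomial chosen in the factor [j], so the
    column sums are the total exponents. *)
Lemma prod_chs (t : 'S_r) :
  \prod_j (if (t j <= n j)%N then chs B X (n j - t j) else 0)
   = \sum_(A : {ffun 'I_r -> {ffun 'I_r -> 'I_B}} |
             [forall j, (\sum_l A j l + t j == n j)%N])
       \prod_l X l ^+ (\sum_j A j l).
Proof.
transitivity (\prod_j \sum_(a : {ffun 'I_r -> 'I_B} | (\sum_l a l + t j == n j)%N)
                \prod_l X l ^+ a l).
  apply: eq_bigr => j _; case: leqP => tn.
    by rewrite chsE; apply: eq_bigl => a; rewrite -(eqn_add2r (t j)) subnK.
  by rewrite big_pred0 // => a; lia.
rewrite bigA_distr_big_dep /=; apply: eq_big => [A|A _].
  by apply/familyP/forallP => H j; have := H j.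
rewrite exchange_big /=; apply: eq_bigr => l _.
by rewrite expr_sum.
Qed.

Lemma mcoeff_sign (b : bool) (p : {mpoly int[r]}) e :
  ((-1) ^+ b * p)@_e = (-1) ^+ b * p@_e.
Proof. by case: b; rewrite ?expr1 ?mulN1r ?mcoeffN // expr0 !mul1r. Qed.

(** Compare the coefficients of the monomial with exponents [n l] in [jacobi_trudi]. On the right
    only the identity contributes, as [n] is injective; on the left [prod_chs] produces the
    arrays. *)
Lemma alternating_count :
  \sum_(t : 'S_r) \sum_(s : 'S_r)
    (-1) ^+ t * (-1) ^+ s * (#|alt_arrays t s|%:R : int) = 1.
Proof.
have := congr1 (mcoeff [multinom n l | l < r]) (jacobi_trudi X nB rB).
rewrite !det_expr.
have -> : (\sum_(s : 'S_r) (-1) ^+ s * \prod_l X l ^+ n (s l))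
            @_[multinom n l | l < r] = 1.
  rewrite raddf_sum (bigD1 1%g) //= [X in _ + X]big1 ?addr0 => [|s ns].
    rewrite odd_perm1 expr0 mul1r (prod_mvar (fun l => n ((1%g : 'S_r) l))) mcoeffX.
    by rewrite (_ : _ == _) //; apply/eqP/mnmP=> l; rewrite !mnmE perm1.
  rewrite (prod_mvar (fun l => n (s l))) mcoeff_sign mcoeffX.
  case: eqP => [/mnmP e|]; last by rewrite mulr0.
  case/eqP: ns; apply/permP=> l; apply: n_inj; have := e l.
  by rewrite !mnmE perm1.
move=> E; rewrite -[RHS]E {1}/determinant; symmetry.
rewrite big_distrl raddf_sum /=; apply: eq_bigr => t _.
rewrite big_distrr raddf_sum /=; apply: eq_bigr => s _.
under eq_bigr do rewrite mxE.
rewrite prod_chs.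
rewrite mulrACA -!signr_addb mcoeff_sign; congr (_ * _).
rewrite big_distrl raddf_sum -sum1_card natr_sum /= big_mkcond [RHS]big_mkcond.
apply: eq_bigr => A _; rewrite inE; case: ifP => // _.
rewrite -big_split /=.
under eq_bigr do rewrite -exprD.
rewrite (prod_mvar (fun l => \sum_j A j l + s l)%N) mcoeffX.
rewrite (_ : (_ == _) = [forall l, (\sum_j A j l + s l == n l)%N]).
  by case: ifP.
apply/eqP/forallP => [/mnmP e l|e]; last apply/mnmP=> l.
  by have := e l; rewrite !mnmE => ->.
by rewrite !mnmE; apply/eqP.
Qed.
End AlternatingCount.

(** * Irreducibility of the Frobenius character and integrality *)

Definition vdm r (n : 'I_r -> nat) : int :=
  \prod_(i < r) \prod_(j < r | (i < j)%N) ((n j)%:Z - (n i)%:Z).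

Lemma vdm_neq0 r (n : 'I_r -> nat) : injective n -> vdm n != 0.
Proof.
move=> n_inj; apply/prodf_neq0=> k _; apply/prodf_neq0=> j kj.
by rewrite subr_eq0 eqz_nat; apply: contraTneq kj => /n_inj ->; rewrite ltnn.
Qed.

Section FrobeniusCharacter.
Variables (r N : nat) (n : 'I_r -> nat).
Hypothesis n_inj : injective n.
Hypothesis sum_n : (\sum_j n j = N + \sum_(j < r) j)%N.

(** The content is [n j - s j], where [s] indexes a term of the Vandermonde determinant; there are
    no such words if some [s j > n j]. *)
Definition words_of (s : 'S_r) : {set {ffun 'I_N -> 'I_r}} :=
  [set w : {ffun 'I_N -> 'I_r} | [forall j, (fiber w setT j + s j == n j)%N]].

(* The value at [g] is the coefficient of [\prod_j x_j ^ n_j] in the product of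
   the Vandermonde determinant of [x] and the power sum of cycle type [g]. *)
Definition frob (g : {perm 'I_N}) : int :=
  \sum_(s : 'S_r) (-1) ^+ s * (\sum_(w in words_of s) preserves w g)%:R.

Lemma sum_perm_ord (s : 'S_r) : (\sum_j s j = \sum_(j < r) j)%N.
Proof. by rewrite [RHS](reindex_inj (@perm_inj _ s)). Qed.

Lemma fiber_le (T C : finType) (w : T -> C) c : (fiber w setT c <= #|T|)%N.
Proof. exact: max_card. Qed.

(** Each inner sum counts the words of [words_of s] fixed by [g], so it is a permutation character;
    [frob] is a signed sum of these. *)
Lemma frob_vchar :
  exists2 phi : 'CF([set: {perm 'I_N}]),
    phi \in 'Z[irr [set: {perm 'I_N}]]%g & forall g, phi g = (frob g)%:~R.
Proof.
have /fin_all_exists2[phi phi_char phiE] (s : 'S_r) :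
  exists2 phi : 'CF([set: {perm 'I_N}]), phi \is a character
    & forall g, phi g = (\sum_(w in words_of s) preserves w g)%:R.
  have acts_s : [acts [set: {perm 'I_N}], on words_of s | word_action N 'I_r].
    apply/actsP=> g _ w; rewrite !inE; apply: eq_forallb => j.
    by rewrite fiber_word_act.
  have [phi phi_char E] := perm_char acts_s; exists phi => // g.
  rewrite E ?inE // -sum1_card; congr _%:R.
  rewrite big_mkcond [RHS]big_mkcond /=; apply: eq_bigr => w _.
  by rewrite inE word_act_fix; case: (w \in _) => //=; case: preserves.
exists (\sum_(s : 'S_r) (-1) ^+ s *: phi s) => [|g].
  by apply: rpred_sum => s _; rewrite rpredZsign char_vchar.
rewrite sum_cfunE /frob rmorph_sum; apply: eq_bigr => s _.
by rewrite cfunE phiE rmorphM rmorph_sign rmorph_nat.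
Qed.

(** Large enough to bound every letter count, every [n j] and [r], as array entries and
    [alternating_count] require. *)
Let B := (N + r + \sum_j n j)%N.

Definition pair_words (t s : 'S_r) : {set {ffun 'I_N -> 'I_r * 'I_r}} :=
  [set p : {ffun 'I_N -> 'I_r * 'I_r} |
     ([ffun a => (p a).1] \in words_of t) && ([ffun a => (p a).2] \in words_of s)].

Lemma fiber_fst (p : {ffun 'I_N -> 'I_r * 'I_r}) j :
  fiber [ffun a => (p a).1] setT j = (\sum_l fiber p setT (j, l))%N.
Proof.
rewrite /fiber -sum1_card (partition_big (fun a => (p a).2) xpredT) //=.
apply: eq_bigr => l _; rewrite -sum1_card; apply: eq_bigl => a.
by rewrite !inE ffunE; case: (p a) => x y; rewrite xpair_eqE.
Qed.

Lemma fiber_snd (p : {ffun 'I_N -> 'I_r * 'I_r}) l :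
  fiber [ffun a => (p a).2] setT l = (\sum_j fiber p setT (j, l))%N.
Proof.
rewrite /fiber -sum1_card (partition_big (fun a => (p a).1) xpredT) //=.
apply: eq_bigr => j _; rewrite -sum1_card; apply: eq_bigl => a.
by rewrite !inE ffunE; case: (p a) => x y; rewrite xpair_eqE andbC.
Qed.

(** Group the words in pairs by their array of letter counts. By [card_words], the words with a
    given array have total weight N!. *)
Lemma sum_pair_words (t s : 'S_r) :
  (\sum_(p in pair_words t s) \prod_c (fiber p setT c)`!
     = N`! * #|alt_arrays B.+1 n t s|)%N.
Proof.
pose arr (p : {ffun 'I_N -> 'I_r * 'I_r}) : {ffun 'I_r -> {ffun 'I_r -> 'I_B.+1}} :=
  [ffun j => [ffun l => inord (fiber p setT (j, l))]].
have arrE p j l : arr p j l = fiber p setT (j, l) :> nat.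
  rewrite !ffunE inordK // ltnS (leq_trans (fiber_le _ _)) // card_ord /B.
  by rewrite -addnA leq_addr.
rewrite (partition_big arr (mem (alt_arrays B.+1 n t s))) /= => [|p]; last first.
  rewrite !inE => /andP[/forallP Ht /forallP Hs].
  apply/andP; split; apply/forallP=> j.
    by rewrite (eq_bigr _ (fun l _ => arrE p j l)) -fiber_fst.
  by rewrite (eq_bigr _ (fun l _ => arrE p l j)) -fiber_snd.
rewrite mulnC -sum_nat_const; apply: eq_bigr => A.
rewrite inE => /andP[/forallP Ht /forallP Hs].
have sA : (\sum_c (A c.1 c.2 : nat) = N)%N.
  apply/eqP; rewrite -(eqn_add2r (\sum_(j < r) j)) -sum_n -(sum_perm_ord t).
  rewrite -(pair_bigA _ (fun j l => A j l : nat)) /= -big_split /=.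
  by apply/eqP; apply: eq_bigr => j _; apply/eqP.
rewrite -(card_words sA) -sum1_card big_distrl /=.
have mem_arr p : (p \in pair_words t s) && (arr p == A) =
    [forall c, fiber p setT c == A c.1 c.2].
  apply/andP/forallP => [[_ /eqP<-] [j l]|E]; first by rewrite arrE.
  have E' j l : fiber p setT (j, l) = A j l by apply/eqP/(E (j, l)).
  split; last by apply/eqP/ffunP=> j; apply/ffunP=> l; apply: val_inj; rewrite /= arrE.
  rewrite !inE; apply/andP; split; apply/forallP=> j.
    by rewrite fiber_fst (eq_bigr _ (fun l _ => E' j l)).
  by rewrite fiber_snd (eq_bigr _ (fun l _ => E' l j)).
apply: eq_big => [p|p]; rewrite mem_arr ?inE // => /forallP E.
by rewrite mul1n; apply: eq_bigr => c _; rewrite (eqP (E c)).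
Qed.

(** A permutation preserves two words exactly when it preserves the word of pairs, so exchanging the
    sums reduces to [card_preserves]. *)
Lemma sum_preserves_pair (t s : 'S_r) :
  (\sum_g (\sum_(w in words_of t) preserves w g) *
          (\sum_(v in words_of s) preserves v g)
     = N`! * #|alt_arrays B.+1 n t s|)%N.
Proof.
rewrite -sum_pair_words.
under eq_bigr do rewrite big_distrlr /= pair_big /=.
rewrite exchange_big /=.
pose h (p : {ffun 'I_N -> 'I_r * 'I_r}) : {ffun 'I_N -> 'I_r} * {ffun 'I_N -> 'I_r} :=
  ([ffun a => (p a).1], [ffun a => (p a).2]).
pose h' (u : {ffun 'I_N -> 'I_r} * {ffun 'I_N -> 'I_r}) : {ffun 'I_N -> 'I_r * 'I_r} :=
  [ffun a => (u.1 a, u.2 a)].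
rewrite (reindex h) /=; last first.
  exists h' => [p _|[u v] _]; last by congr pair; apply/ffunP=> a; rewrite !ffunE.
  by apply/ffunP=> a; rewrite !ffunE /=; case: (p a).
apply: eq_big => [p|p _]; first by rewrite [RHS]inE.
rewrite -card_preserves; apply: eq_bigr => g _; rewrite mulnb; congr nat_of_bool.
apply/andP/preservesP => [[/preservesP H1 /preservesP H2] a|H].
  by have := H1 a; have := H2 a; rewrite !ffunE; case: (p a) (p _) => ? ? [? ?] /= -> ->.
by split; apply/preservesP=> a; rewrite !ffunE H.
Qed.

Lemma sum_frob_sqr : \sum_g frob g * frob g = N`!%:R.
Proof.
have nB j : (n j < B.+1)%N.
  by rewrite ltnS /B (bigD1 j) //= [(n j + _)%N]addnC addnA leq_addl.
have rB : (r <= B.+1)%N by rewrite /B; lia.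
rewrite -[RHS]mulr1 -[X in _ * X](alternating_count n_inj nB rB).
under eq_bigr do rewrite /frob big_distrlr /=.
rewrite exchange_big big_distrr /=; apply: eq_bigr => t _.
rewrite exchange_big big_distrr /=; apply: eq_bigr => s _.
under eq_bigr do rewrite mulrACA -natrM.
by rewrite -big_distrr /= -natr_sum sum_preserves_pair natrM mulrCA.
Qed.

(** By [sum_frob_sqr] the virtual character has norm 1. Its sign may stay undetermined: only
    quotients by [frob 1] are used later. *)
Lemma frob_irr :
  exists (b : bool) (i : Iirr [set: {perm 'I_N}]),
    forall g, (frob g)%:~R = (-1) ^+ b * 'chi_i g.
Proof.
have [phi phiZ phiE] := frob_vchar.
have [|b [i Ephi]] := vchar_norm1P phiZ; last first.
  by exists b, i => g; rewrite -phiE Ephi cfunE.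
rewrite cfdotE cardsT card_Sn.
rewrite (eq_bigr (fun g => (frob g * frob g)%:~R)) => [|g _]; last first.
  by rewrite !phiE rmorphM /= conj_intr.
rewrite -rmorph_sum /= (eq_bigl xpredT) => [|g]; last by rewrite inE.
by rewrite sum_frob_sqr rmorph_nat mulVf // pnatr_eq0 -lt0n fact_gt0.
Qed.

(** The quotient is an integer combination of central character values |class| chi(x) / chi(1),
    hence an algebraic integer; being rational, it is an integer. *)
Lemma frob_class_sum (y : {perm 'I_N} -> int) : frob 1%g != 0 ->
  (forall g h, y (g ^ h)%g = y g) ->
  exists z : int, \sum_g y g * frob g = z * frob 1%g.
Proof.
move=> nz1 yJ; have [b [i E]] := frob_irr.
pose q : algC := (\sum_g y g * frob g)%:~R / (frob 1%g)%:~R.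
have qA : q \in Aint.
  rewrite /q rmorph_sum /= (eq_bigl (fun g => g \in [set: {perm 'I_N}])); last first.
    by move=> g; rewrite inE.
  rewrite sum_by_classes; last first.
    by move=> g h gG hG; rewrite !rmorphM /= !E cfunJ // yJ.
  rewrite big_distrl; apply: rpred_sum => xG /imsetP[x xin ->].
  set x' := repr _.
  have [h hG Ex'] : exists2 h, h \in [set: {perm 'I_N}] & x' = (x ^ h)%g.
    by apply/imsetP; apply: mem_repr (class_refl _ x).
  rewrite /= rmorphM /= !E Ex' cfunJ // yJ.
  rewrite (_ : _ / _ = (y x)%:~R *
      (#|(x ^: [set: {perm 'I_N}])%g|%:R * 'chi_i x / 'chi_i 1%g)).
    by rewrite rpredM ?Aint_class_div_irr1 // Aint_int.
  have sb : ((-1) ^+ b : algC) != 0 by rewrite signr_eq0.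
  move: sb (irr1_neq0 i); rewrite -/x'; set k := _%:R.
  by move: k (_ ^+ b) ('chi_i x) ('chi_i _) => k e a d; move=> e0 d0; field; rewrite d0.
have qR : q \in Crat by rewrite /q rpred_div ?rpred_int.
have /intrP[z Ez] := Cint_rat_Aint qR qA.
exists z; apply: (@intr_inj algC); rewrite rmorphM /= -Ez /q divfK //.
by rewrite intr_eq0.
Qed.

(** * The Hermite Wronskian as a sum over involutions *)

Definition wron_herm (R : comNzRingType) : {poly R} :=
  \det (\matrix_(i < r, j < r) (herm R (n j))^`(i)).

(** Converts the falling factorials coming from derivatives into numbers of words; both sides vanish
    if some [s j > n j]. *)
Lemma card_words_of (s : 'S_r) :
  (#|words_of s| * \prod_j (n j)`! = N`! * \prod_j (n j) ^_ (s j))%N.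
Proof.
have [/forallP le_sn|/forallPn[j]] := boolP [forall j, (s j <= n j)%N]; last first.
  rewrite -ltnNge => lt_ns; rewrite [X in (_ * X)%N = _](bigD1 j) //=.
  rewrite [X in _ = (_ * X)%N](bigD1 j) //= ffact_small // mul0n muln0.
  rewrite (_ : #|_| = 0)%N //; apply: eq_card0 => w; rewrite !inE.
  by apply/negP=> /forallP/(_ j); lia.
have sA : (\sum_j (n j - s j) = N)%N.
  apply/eqP; rewrite -(eqn_add2r (\sum_j s j)) -big_split /= sum_perm_ord -sum_n.
  by apply/eqP; apply: eq_bigr => j _; rewrite subnK.
rewrite -(card_words sA) mulnC [RHS]mulnC mulnCA.
have -> : words_of s = [set w : {ffun 'I_N -> 'I_r} |
            [forall j, (fiber w setT j == n j - s j)%N]].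
  apply/setP=> w; rewrite !inE; apply: eq_forallb => j.
  by rewrite -(eqn_add2r (s j) _ (n j - s j)) subnK.
rewrite [RHS]mulnC; congr (_ * _)%N; rewrite -big_split /=.
by apply: eq_bigr => j _; rewrite ffact_fact.
Qed.

(* The matching expansion of Hermite polynomials, [sum_invol], makes this a
   multiple of the Wronskian, while its coefficients are sums of [frob] over
   conjugacy classes of involutions. *)
Definition invol_sum : {poly int} :=
  \sum_(g : {perm 'I_N}) ((g * g == 1)%g)%:R * ((-1) ^+ g * 'X^(nfix setT g))
     * (frob g)%:~R.

Lemma invol_sumE :
  invol_sum = \sum_(s : 'S_r) (-1) ^+ s *
     (#|words_of s|%:R * \prod_j herm int (n j - s j)).
Proof.
transitivity (\sum_(s : 'S_r) (-1) ^+ s *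
    \sum_(w in words_of s) \sum_g invol_weight int w setT g).
  rewrite /invol_sum /frob.
  under eq_bigr do rewrite rmorph_sum big_distrr /=.
  rewrite exchange_big /=; apply: eq_bigr => s _.
  rewrite exchange_big big_distrr /=; apply: eq_bigr => g _.
  rewrite rmorphM rmorph_sign rmorph_nat mulrCA; congr (_ * _).
  rewrite natr_sum big_distrr /=; apply: eq_bigr => w _.
  by rewrite /invol_weight -mulnb natrM mulrAC.
apply: eq_bigr => s _; congr (_ * _).
rewrite -sum1_card natr_sum big_distrl /=; apply: eq_bigr => w.
rewrite inE => /forallP E; rewrite sum_invol mul1r; apply: eq_bigr => j _.
by rewrite -(eqP (E j)) addnK.
Qed.

Lemma wron_hermE :
  N`!%:R * wron_herm int = (\prod_j (n j)`!)%:R * invol_sum.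
Proof.
rewrite invol_sumE /wron_herm -det_tr /determinant !big_distrr /=.
apply: eq_bigr => s _; rewrite mulrCA [RHS]mulrCA; congr (_ * _).
rewrite mulrA -natrM mulnC card_words_of natrM -mulrA; congr (_ * _).
rewrite natr_prod -big_split /=; apply: eq_bigr => j _.
by rewrite !mxE derivn_herm.
Qed.

(** Being monic of degree [i], these polynomials differ from the powers by a unitriangular change of
    basis, which gives [det_ffact]. *)
Definition ffact_poly (i : nat) : {poly int} := \prod_(t < i) ('X - t%:R%:P).

Lemma horner_ffact_poly i k : (ffact_poly i).[k%:R] = (k ^_ i)%:R.
Proof.
rewrite /ffact_poly horner_prod ffact_prod natr_prod.
have [le|lt] := leqP i k.
  apply: eq_bigr => t _; rewrite !hornerE natrB //.
  exact: leq_trans (ltnW (ltn_ord t)) le.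
rewrite (bigD1 (Ordinal lt)) //= [RHS](bigD1 (Ordinal lt)) //=.
by rewrite !hornerE subrr subnn !mul0r.
Qed.

Lemma det_ffact : \det (\matrix_(i < r, j < r) ((n j ^_ i)%:R : int))
  = vdm n.
Proof.
transitivity (\det (Vandermonde r (\row_(j < r) ((n j)%:R : int)))); last first.
  rewrite det_Vandermonde; apply: eq_bigr => i _; apply: eq_bigr => j _.
  by rewrite !mxE !natz.
have sz i : size (ffact_poly i) = i.+1.
  by rewrite size_prod_XsubC /index_enum -enumT size_enum_ord.
have -> : \matrix_(i < r, j < r) ((n j ^_ i)%:R : int)
   = \matrix_(i, k) (ffact_poly i)`_k *m Vandermonde r (\row_(j < r) (n j)%:R).
  apply/matrixP=> i j; rewrite !mxE -horner_ffact_poly.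
  rewrite (@horner_coef_wide _ r) ?sz //.
  by apply: eq_bigr => k _; rewrite !mxE.
rewrite det_mulmx det_trig; last first.
  by apply/is_trig_mxP=> i j ij; rewrite mxE nth_default // sz.
rewrite big1 ?mul1r // => i _; rewrite mxE.
have /monicP : ffact_poly i \is monic by apply: monic_prod_XsubC.
by rewrite lead_coefE sz.
Qed.

(** Frobenius' degree formula, by the same expansion as [wron_hermE]: the identity preserves every
    word. *)
Lemma frob1 : N`!%:R * \det (\matrix_(i < r, j < r) ((n j ^_ i)%:R : int))
  = (\prod_j (n j)`!)%:R * frob 1%g.
Proof.
rewrite /frob -det_tr /determinant !big_distrr /=; apply: eq_bigr => s _.
rewrite mulrCA [RHS]mulrCA; congr (_ * _).
have -> : (\sum_(w in words_of s) preserves w 1%g = #|words_of s|)%N.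
  rewrite -sum1_card; apply: eq_bigr => w _.
  by case: preservesP => // -[] a; rewrite perm1.
rewrite -natrM mulnC card_words_of natrM natr_prod; congr (_ * _).
by apply: eq_bigr => j _; rewrite !mxE.
Qed.

(** Dividing [wron_hermE] by [frob1] cancels the factorials, leaving a class sum over [frob 1] that
    [frob_class_sum] shows to be an integer. *)
Lemma wron_herm_dvd i :
  exists z : int, (wron_herm int)`_i = z * vdm n.
Proof.
rewrite -det_ffact; set D := \det _.
have nzD : D != 0 by rewrite /D det_ffact vdm_neq0.
have nzN : (N`!%:R : int) != 0 by rewrite pnatr_eq0 -lt0n fact_gt0.
have nz1 : frob 1%g != 0.
  apply: contra_neq (mulf_neq0 nzN nzD) => E1.
  by rewrite /D frob1 E1 mulr0.
(* Selects the involutions with [i] fixed points, with sign; conjugation changes neither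
   condition. *)
pose y (g : {perm 'I_N}) : int :=
  ((g * g == 1)%g)%:R * ((-1) ^+ g * (i == nfix setT g)%:R).
have yJ g h : y (g ^ h)%g = y g.
  rewrite /y -conjMg -(inj_eq (conjg_inj h^-1%g)) conjgK conj1g odd_permJ.
  congr (_ * (_ * (i == _)%:R)); rewrite /nfix -[RHS](card_imset _ (@perm_inj _ h)).
  apply: eq_card => a; rewrite !inE; apply/idP/imsetP => [/eqP Ea|[b]].
    exists (h^-1%g a); rewrite ?permKV // !inE.
    apply/eqP; apply: (@perm_inj _ h); rewrite permKV -{2}Ea.
    by rewrite -{2}[a](permKV h) permJ.
  by rewrite !inE => /eqP Eb ->; rewrite permJ Eb eqxx.
have [z Ez] := frob_class_sum nz1 yJ.
exists z; apply: (mulfI nzN); rewrite mulrCA frob1 mulrCA -Ez.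
have := congr1 (fun p : {poly int} => p`_i) wron_hermE.
rewrite -!scale_natr !coefZ => ->; congr (_ * _).
rewrite /invol_sum coef_sum; apply: eq_bigr => g _.
rewrite -[frob g]intz -(rmorph_int polyC) coefMC !intz; congr (_ * _).
rewrite -scale_natr coefZ; congr (_ * _).
by case: (odd_perm g); rewrite ?expr1 ?mulN1r ?coefN ?expr0 ?mul1r coefXn.
Qed.

End FrobeniusCharacter.

(** * Reduction modulo an odd integer *)

Section PermuteColumns.
Variables (R : comNzRingType) (r : nat).

(** Sorting the residues changes the Wronskian and the Vandermonde product by the same sign; both
    are instances of this. *)
Lemma det_perm_cols (F : 'I_r -> nat -> R) (n n' : 'I_r -> nat) (p : 'S_r) :
  (forall j, n' j = n (p j)) ->
  \det (\matrix_(i, j) F i (n' j)) = (-1) ^+ p * \det (\matrix_(i, j) F i (n j)).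
Proof.
move=> En; have -> : \matrix_(i, j) F i (n' j) = col_perm p (\matrix_(i, j) F i (n j)).
  by apply/matrixP=> i j; rewrite !mxE En.
by rewrite col_permE det_mulmx det_perm odd_permV mulrC.
Qed.

Lemma det_scale_cols (A : 'M[R]_r) (d : 'I_r -> R) :
  \det (\matrix_(i, j) (d j * A i j)) = (\prod_j d j) * \det A.
Proof.
have -> : \matrix_(i, j) (d j * A i j) = A *m diag_mx (\row_j d j).
  by apply/matrixP=> i j; rewrite mul_mx_diag !mxE mulrC.
by rewrite det_mulmx det_diag mulrC; congr (_ * _); apply: eq_bigr => j _; rewrite mxE.
Qed.
End PermuteColumns.

Lemma map_wron_herm (R : comNzRingType) r (n : 'I_r -> nat) :
  map_poly intr (wron_herm n int) = wron_herm n R.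
Proof.
rewrite /wron_herm -det_map_mx; congr (\det _); apply/matrixP=> i j.
by rewrite !mxE /= -derivn_map map_herm.
Qed.

Section ReduceModOdd.
Variables (m r : nat) (n : 'I_r -> nat).
Hypotheses (m_gt1 : (1 < m)%N) (m_odd : odd m).

Lemma wron_herm_mod :
  wron_herm n 'Z_m
    = 'X^(\sum_j n j %/ m * m) * wron_herm (fun j => n j %% m)%N 'Z_m.
Proof.
rewrite /wron_herm expr_sum -det_scale_cols; congr (\det _).
apply/matrixP=> i j; rewrite !mxE {1}(divn_eq (n j) m).
by rewrite herm_addMm // derivn_expMm.
Qed.

Lemma vdm_mod : ((vdm n)%:~R : 'Z_m) = (vdm (fun j => n j %% m)%N)%:~R.
Proof.
rewrite !rmorph_prod; apply: eq_bigr => i _; rewrite !rmorph_prod.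
by apply: eq_bigr => j _; rewrite !rmorphB /= -!pmulrn !Zp_nat_mod.
Qed.

End ReduceModOdd.

Lemma intr_Zp_eq0 m (z : int) : (1 < m)%N ->
  (z%:~R : 'Z_m) = 0 -> exists z', z = m%:Z * z'.
Proof.
move=> m_gt1 z0; suff /dvdzP[q ->] : (m%:Z %| z)%Z by exists q; rewrite mulrC.
have {}z0 : (`|z|%:R : 'Z_m) = 0.
  apply/eqP; move: z0; rewrite {1}[z]intEsign rmorphM rmorph_sign /= -pmulrn.
  by case: (z < 0)%R; rewrite ?expr1 ?mulN1r ?expr0 ?mul1r => /eqP; rewrite ?oppr_eq0.
rewrite dvdzE /dvdn; have := congr1 (@nat_of_ord _) z0.
by rewrite /= val_Zp_nat // => ->.
Qed.

Lemma coprimez_Zp_inv m (z : int) : (1 < m)%N -> coprimez m%:Z z ->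
  exists v : 'Z_m, v * z%:~R = 1.
Proof.
move=> m_gt1 /coprimezP[[u v] /= E]; exists v%:~R.
have := congr1 (fun t : int => (t%:~R : 'Z_m)) E.
by rewrite /= rmorphD !rmorphM /= -pmulrn pchar_Zp // mulr0 add0r.
Qed.

Section QuotientPolynomial.
Variables (r N : nat) (n : 'I_r -> nat).
Hypothesis n_inj : injective n.
Hypothesis sum_n : (\sum_j n j = N + \sum_(j < r) j)%N.

Lemma wron_herm_quotient : exists P : {poly int}, wron_herm n int = vdm n *: P.
Proof.
exists (\poly_(i < size (wron_herm n int)) ((wron_herm n int)`_i %/ vdm n)%Z).
apply/polyP=> i; rewrite coefZ coef_poly; case: ltnP => [_|le]; last first.
  by rewrite mulr0 nth_default.
have [z ->] := wron_herm_dvd n_inj sum_n i.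
by rewrite mulzK ?vdm_neq0 // mulrC.
Qed.
End QuotientPolynomial.

(** * Partitions and degree sequences as lists *)

Lemma WrE fs r : size fs = r ->
  Wr fs = \det (\matrix_(i < r, j < r) (nth 0 fs j)^`(i)).
Proof. by move=> <-. Qed.

Lemma Wr_He s r (n : 'I_r -> nat) : size s = r ->
  (forall j : 'I_r, nth 0%N s j = n j) ->
  Wr [seq He k | k <- s] = map_poly intr (wron_herm n int).
Proof.
move=> sz En; rewrite map_wron_herm (@WrE _ r) ?size_map //.
congr (\det _); apply/matrixP=> i j.
by rewrite !mxE (nth_map 0%N) ?sz // He_herm En.
Qed.

Lemma DeltaE s r (n : 'I_r -> nat) : size s = r ->
  (forall j : 'I_r, nth 0%N s j = n j) -> Delta s = vdm n.
Proof.
move=> sz; move: n; rewrite -sz => n En; apply: eq_bigr => i _.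
by apply: eq_bigr => j _; rewrite !En.
Qed.

Lemma size_degseq l : size (degseq l) = size l.
Proof. by rewrite size_map size_iota. Qed.

Lemma nth_degseq l i : (i < size l)%N ->
  nth 0%N (degseq l) i = (nth 0%N (rev l) i + i)%N.
Proof. by move=> lt; rewrite (nth_map 0%N) ?size_iota // nth_iota. Qed.

Lemma degseq_sorted l : is_partition l -> sorted ltn (degseq l).
Proof.
move=> part; have sl : sorted leq (rev l) by rewrite rev_sorted.
apply/(sortedP 0%N) => i; rewrite size_degseq => lt.
rewrite !nth_degseq //; last exact: ltnW.
have := elimT (sortedP 0%N) sl i; rewrite size_rev => /(_ lt) /=; lia.
Qed.

Lemma degseq_uniq l : is_partition l -> uniq (degseq l).
Proof. by move/degseq_sorted/sorted_uniq; apply; [apply: ltn_trans|apply: ltnn]. Qed.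

Lemma degseq_inj l l' : size l = size l' -> degseq l = degseq l' -> l = l'.
Proof.
move=> sz E; apply: (can_inj revK); apply: (@eq_from_nth _ 0%N).
  by rewrite !size_rev.
move=> i; rewrite size_rev => lt; have := congr1 (fun s => nth 0%N s i) E.
by rewrite /= !nth_degseq -?sz // => /addIn.
Qed.

Lemma sum_nth_sumn s r : size s = r -> (\sum_(j < r) nth 0 s j = sumn s)%N.
Proof. by move=> <-; rewrite sumnE (big_nth 0%N) big_mkord. Qed.

Lemma sum_degseq l r : size l = r ->
  (\sum_(j < r) nth 0 (degseq l) j = psize l + \sum_(j < r) j)%N.
Proof.
move=> sz; rewrite /psize -sumn_rev -(@sum_nth_sumn _ r) ?size_rev //.
by rewrite -big_split; apply: eq_bigr => j _; rewrite nth_degseq ?sz.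
Qed.

(** The integer polynomial comes with a division-free equation, which can be mapped to ['Z_m]. *)
Lemma He_part_int l r (n : 'I_r -> nat) : is_partition l -> size l = r ->
    (forall j : 'I_r, nth 0%N (degseq l) j = n j) ->
  exists2 P : {poly int}, He_part l = map_poly intr P
    & wron_herm n int = vdm n *: P.
Proof.
move=> part sz En.
have n_inj : injective n.
  move=> i j; rewrite -!En => /eqP.
  by rewrite nth_uniq ?size_degseq ?sz ?degseq_uniq // => /eqP/val_inj.
have sum_n : (\sum_j n j = psize l + \sum_(j < r) j)%N.
  by rewrite -(sum_degseq sz); apply: eq_bigr.
have [P EP] := wron_herm_quotient n_inj sum_n; exists P => //.
have szd : size (degseq l) = r by rewrite size_degseq.
rewrite /He_part (DeltaE szd En) (Wr_He szd En) EP map_polyZ /=.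
by rewrite scalerA mulVf ?scale1r // intr_eq0 vdm_neq0.
Qed.

Lemma ltn_sorted_ge s i : sorted ltn s -> (i < size s)%N -> (i <= nth 0 s i)%N.
Proof.
move=> ss; elim: i => // i IHi lt; apply: leq_ltn_trans (IHi (ltnW lt)) _.
exact: elimT (sortedP 0%N) ss i lt.
Qed.

Lemma degseq_surj s : sorted ltn s ->
  exists mu, [/\ is_partition mu, size mu = size s & degseq mu = s].
Proof.
(* Inverse of [degseq]; no subtraction truncates, by [ltn_sorted_ge]. *)
move=> ss; pose t := [seq (nth 0 s i - i)%N | i <- iota 0 (size s)].
have szt : size t = size s by rewrite size_map size_iota.
have nt i : (i < size s)%N -> nth 0%N t i = (nth 0 s i - i)%N.
  by move=> lt; rewrite (nth_map 0%N) ?size_iota // nth_iota.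
exists (rev t); split; last 1 first.
- apply: (@eq_from_nth _ 0%N); first by rewrite size_degseq size_rev.
  move=> i; rewrite size_degseq size_rev szt => lt.
  rewrite nth_degseq ?size_rev ?szt // revK nt // subnK //.
  exact: ltn_sorted_ge.
- rewrite /is_partition rev_sorted; apply/(sortedP 0%N) => i; rewrite szt => lt.
  rewrite !nt //; last exact: ltnW.
  have := elimT (sortedP 0%N) ss i lt; have := ltn_sorted_ge ss lt.
  by rewrite /geq /=; lia.
by rewrite size_rev.
Qed.

Theorem mainTheorem5 (lam : seq nat) (m : nat) :
  is_partition lam ->
  (3 <= m)%N -> odd m ->
  coprimez (m%:Z) (Delta (degseq lam)) ->
  let res := [seq (k %% m)%N | k <- degseq lam] in
  uniq res /\
  exists mu : seq nat,
    [/\ is_partition mu, size mu = size lam, perm_eq (degseq mu) res,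
        (forall nu : seq nat, is_partition nu -> size nu = size lam ->
           perm_eq (degseq nu) res -> nu = mu) &
        forall i : nat, exists z : int,
          (He_part lam - 'X^(psize lam - psize mu) * He_part mu)`_i
            = (m%:Z * z)%:~R].
Proof.
move=> part m_ge3 m_odd cop res.
have m_gt1 : (1 < m)%N by apply: leq_trans m_ge3.
pose r := size lam; pose n (j : 'I_r) := nth 0%N (degseq lam) j.
pose rho (j : 'I_r) := (n j %% m)%N.
have szd : size (degseq lam) = r by rewrite size_degseq.
have Dn : Delta (degseq lam) = vdm n by apply: DeltaE.
rewrite Dn in cop; have [v Ev] := coprimez_Zp_inv m_gt1 cop.
have szr : size res = r by rewrite size_map.
have nth_res (j : 'I_r) : nth 0%N res j = rho j by rewrite (nth_map 0%N) ?szd.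
(* Equal residues would give a zero factor in [vdm n] modulo [m], which is a unit with inverse
   [v]. *)
have vdm0 (i j : 'I_r) : (i < j)%N -> rho i != rho j.
  move=> ij; apply/eqP=> eij; have := oner_neq0 ('Z_m).
  rewrite -Ev vdm_mod // rmorph_prod (bigD1 i) //= rmorph_prod (bigD1 j) //=.
  by rewrite -/(rho i) -/(rho j) eij subrr !mul0r mulr0 eqxx.
have res_uniq : uniq res.
  apply/(uniqP 0%N) => i j; rewrite !inE szr => ir jr.
  rewrite (nth_res (Ordinal ir)) (nth_res (Ordinal jr)) => eij.
  case: (ltngtP i j) => // lt; last first.
    by have := @vdm0 (Ordinal jr) (Ordinal ir) lt; rewrite eij eqxx.
  by have := @vdm0 (Ordinal ir) (Ordinal jr) lt; rewrite eij eqxx.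
split=> //.
have ss : sorted ltn (sort leq res).
  rewrite ltn_sorted_uniq_leq sort_uniq res_uniq /=.
  by apply: sort_sorted; apply: leq_total.
have [mu [mu_part mu_sz mu_deg]] := degseq_surj ss.
have mu_szl : size mu = r by rewrite mu_sz size_sort szr.
have mu_perm : perm_eq (degseq mu) res by rewrite mu_deg perm_sort.
exists mu; split=> // [nu nu_part nu_sz nu_perm|].
  apply: degseq_inj; first by rewrite nu_sz.
  apply: (irr_sorted_eq ltn_trans ltnn); rewrite ?degseq_sorted //.
  by apply: perm_mem; rewrite (perm_trans nu_perm) // perm_sym.
pose nm (j : 'I_r) := nth 0%N (degseq mu) j.
have [P EP WP] := He_part_int part (erefl r) (fun j => erefl (n j)).
have [Q EQ WQ] := He_part_int mu_part mu_szl (fun j => erefl (nm j)).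
have [p Ep] : exists p : 'S_r, forall j, nm j = rho (p j).
  have szr' : size res == r by apply/eqP.
  have /tuple_permP[p E] : perm_eq (degseq mu) (Tuple szr') by [].
  exists p => j; rewrite -nth_res /nm E.
  by rewrite -[LHS](tnth_nth 0%N) tnth_mktuple (tnth_nth 0%N).
(* Summing both degree sequences also gives [psize mu <= psize lam], so the subtraction is exact. *)
have Edeg : (psize lam - psize mu = \sum_j n j %/ m * m)%N.
  have s1 : (\sum_j n j = psize lam + \sum_(j < r) j)%N by apply: sum_degseq.
  have s2 : (\sum_j nm j = psize mu + \sum_(j < r) j)%N by apply: sum_degseq.
  have s3 : (\sum_j n j = \sum_j n j %/ m * m + \sum_j rho j)%N.
    by rewrite -big_split; apply: eq_bigr => j _; apply: divn_eq.
  have s4 : (\sum_j nm j = \sum_j rho j)%N.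
    rewrite [RHS](reindex_inj (@perm_inj _ p)).
    by apply: eq_bigr => j _; apply: Ep.
  by lia.
have key : map_poly intr P = 'X^(psize lam - psize mu) * map_poly intr Q :> {poly 'Z_m}.
  have W1 : wron_herm n 'Z_m = (vdm n)%:~R *: map_poly intr P.
    by rewrite -map_wron_herm WP map_polyZ.
  have W2 : wron_herm nm 'Z_m = (vdm nm)%:~R *: map_poly intr Q.
    by rewrite -map_wron_herm WQ map_polyZ.
  have W3 : wron_herm nm 'Z_m = (-1) ^+ p * wron_herm rho 'Z_m.
    by apply: (det_perm_cols (fun i k => (herm 'Z_m k)^`(i))).
  have D3 : vdm nm = (-1) ^+ p * vdm rho.
    rewrite -!det_ffact.
    by apply: (det_perm_cols (fun i k => (k ^_ i)%:R)).
  have W4 : wron_herm rho 'Z_m = (vdm rho)%:~R *: map_poly intr Q.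
    move: W2; rewrite W3 D3 rmorphM rmorph_sign /= -scalerA.
    case: (odd_perm p); rewrite ?expr1 ?mulN1r ?scaleN1r ?expr0 ?mul1r ?scale1r //.
    exact: oppr_inj.
  (* Modulo [m] the two Vandermonde products agree, so multiplying by [v] cancels both. *)
  move: W1; rewrite wron_herm_mod // -/rho W4 -Edeg => /(congr1 (fun q => v *: q)).
  rewrite -scalerAr !scalerA -[vdm rho]/(vdm (fun j => n j %% m)%N) -vdm_mod // Ev.
  by rewrite !scale1r => ->.
move=> i; rewrite EP EQ -(map_polyXn intr) -rmorphM -rmorphB /= coef_map /=.
have [|z ->] := @intr_Zp_eq0 m (P - 'X^(psize lam - psize mu) * Q)`_i m_gt1.
  rewrite -(coef_map intr) /= rmorphB rmorphM /= map_polyXn key subrr coef0 //.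
by exists z.
Qed.
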